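(* Let $\psi$ satisfy the interior condition stated in the context. Assume that $f$ is $\mu$-strongly convex relative to $\psi$ on $\mathcal X$ (with $\mu>0$) and that, almost surely, $f_\xi$ is $L$-smooth relative to $\psi$ on $\mathcal X$ (with $L>0$). Let $(x_t)_{t\ge 1}$ be the iterates of stochastic mirror descent with constant stepsize $0<\eta\le \frac1L$. Then for every $x_\ast\in\mathcal X_\ast$ and every $t\ge 1$, $$\mathbb E\left[B_\psi(x_\ast;x_{t+1})\right]\le (1-\mu\eta)^t B_\psi(x_\ast;x_1)+\frac{\sigma_{\mathcal X}^2}{\mu}.$$
   Context: Setting. $\mathcal X\subseteq\mathbb R^d$ is a nonempty closed convex set (possibly unbounded), $\psi:\mathcal D\to\mathbb R$ is a convex function, differentiable on $\operatorname{int}\mathcal D$, with $\mathcal X\subseteq\mathcal D\subseteq\mathbb R^d$. $\xi$ is a random vector supported on a set $\Xi$. The functions $f_\xi$ and $f(x)=\mathbb E_\xi[f_\xi(x)]$ are real-valued on $\mathcal X$ and differentiable at the points of $\mathcal X\cap\operatorname{int}\mathcal D$ (being defined in a neighbourhood of each such point), with $\mathbb E_\xi[\nabla f_\xi(x)]=\nabla f(x)$ there; all expectations involved are assumed well defined. $\mathcal X_\ast$ is the set of minimizers of $f$ over $\mathcal X$, assumed nonempty. Bregman divergence: for a function $h$ differentiable at $y$, $B_h(x;y)=h(x)-h(y)-\langle\nabla h(y),x-y\rangle$. Relative smoothness / strong convexity: $h$ is $L$-smooth relative to $\psi$ on $\mathcal X$ if $B_h(x;y)\le L B_\psi(x;y)$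 for all $(x,y)\in\mathcal X\times(\mathcal X\cap\operatorname{int}\mathcal D)$; $h$ is $\mu$-strongly convex relative to $\psi$ on $\mathcal X$ if $\mu B_\psi(x;y)\le B_h(x;y)$ for all such $(x,y)$. Interior condition on $\psi$: for every $x_t\in\mathcal X\cap\operatorname{int}\mathcal D$, every vector $g$ and every stepsize $\eta_t>0$, the point $x_{t+1}=\arg\min_{x\in\mathcal X}\{\langle g,x\rangle+\frac1{\eta_t}B_\psi(x;x_t)\}$ exists and lies in $\operatorname{int}\mathcal D$. Stochastic mirror descent with constant stepsize $\eta$: $x_1\in\mathcal X\cap\operatorname{int}\mathcal D$ is deterministic, $\xi_1,\xi_2,\dots$ are i.i.d. copies of $\xi$, and $x_{t+1}=\arg\min_{x\in\mathcal X}\{\langle\nabla f_{\xi_t}(x_t),x\rangle+\frac1\eta B_\psi(x;x_t)\}$ for $t\ge1$. Constrained finite optimal objective difference: $\sigma_{\mathcal X}^2=f(x_\ast)-\mathbb E_\xi[f_\xi^\ast(\mathcal X)]$ where $x_\ast\in\mathcal X_\ast$ and $f_\xi^\ast(\mathcal X)=\inf_{x\in\mathcal X}f_\xi(x)$; it is assumed that $\sigma_{\mathcal X}^2<\infty$. *)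

(* Defs.v *)
From HB Require Import structures.
From mathcomp Require Import all_boot all_order all_algebra finmap.
From mathcomp Require Import all_classical all_reals all_analysis measurable_realfun.

Set Implicit Arguments.
Unset Strict Implicit.
Unset Printing Implicit Defensive.

Import Order.TTheory GRing.Theory Num.Theory.
Import numFieldNormedType.Exports.

Local Open Scope classical_set_scope.
Local Open Scope ring_scope.

(* Points of R^d are row vectors 'rV[R]_d.  A function defined only on a part
   of R^d is represented by an arbitrary total extension. *)

Definition dotp (R : realType) (d : nat) (u v : 'rV[R]_d) : R :=
  \sum_(i < d) u 0 i * v 0 i.

(* Only meaningful where h is differentiable. *)
Definition gradient (R : realType) (d : nat) (h : 'rV[R]_d -> R)
    (y : 'rV[R]_d) : 'rV[R]_d :=
  \row_(i < d) 'D_(delta_mx 0 i) (h : 'rV[R]_d -> R^o) y.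

Definition bregman (R : realType) (d : nat) (h : 'rV[R]_d -> R)
    (x y : 'rV[R]_d) : R :=
  h x - h y - dotp (gradient h y) (x - y).

Definition rel_smooth (R : realType) (d : nat) (X D : set 'rV[R]_d)
    (psi : 'rV[R]_d -> R) (L : R) (h : 'rV[R]_d -> R) : Prop :=
  forall x y, X x -> (X `&` D°) y -> bregman h x y <= L * bregman psi x y.

Definition rel_strongly_convex (R : realType) (d : nat) (X D : set 'rV[R]_d)
    (psi : 'rV[R]_d -> R) (mu : R) (h : 'rV[R]_d -> R) : Prop :=
  forall x y, X x -> (X `&` D°) y -> mu * bregman psi x y <= bregman h x y.

Definition argmin_on (R : realType) (d : nat) (X : set 'rV[R]_d)
    (h : 'rV[R]_d -> R) : set 'rV[R]_d :=
  [set x | X x /\ forall z, X z -> h x <= h z].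

Definition mirror_objective (R : realType) (d : nat) (psi : 'rV[R]_d -> R)
    (eta : R) (g y x : 'rV[R]_d) : R :=
  dotp g x + eta^-1 * bregman psi x y.

(* psi need not be strictly convex, so the arg min is a set: it has to be
   nonempty and to lie entirely in the interior of D. *)
Definition interior_condition (R : realType) (d : nat) (X D : set 'rV[R]_d)
    (psi : 'rV[R]_d -> R) : Prop :=
  forall (y g : 'rV[R]_d) (eta : R), (X `&` D°) y -> 0 < eta ->
    argmin_on X (mirror_objective psi eta g y) !=set0 /\
    argmin_on X (mirror_objective psi eta g y) `<=` D°.

(* In what follows Q is the law of the random parameter and F s is the
   function f_s. The `fine` is harmless where s |-> F s x is integrable. *)
Definition mean_fun (R : realType) (d : nat) (dXi : measure_display)
    (Xi : measurableType dXi) (Q : probability Xi R)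
    (F : Xi -> 'rV[R]_d -> R) (x : 'rV[R]_d) : R :=
  fine 'E_Q[fun s => F s x].

Definition inf_on (R : realType) (d : nat) (X : set 'rV[R]_d)
    (h : 'rV[R]_d -> R) : \bar R :=
  ereal_inf [set (h x)%:E | x in X].

(* Extended-real: the inner infimum may be -oo, and so may its integral. *)
Definition sigma2 (R : realType) (d : nat) (dXi : measure_display)
    (Xi : measurableType dXi) (Q : probability Xi R) (X : set 'rV[R]_d)
    (F : Xi -> 'rV[R]_d -> R) (xstar : 'rV[R]_d) : \bar R :=
  ((mean_fun Q F xstar)%:E - \int[Q]_s inf_on X (F s))%E.

Definition mutually_independent (R : realType) (dO dXi : measure_display)
    (Omega : measurableType dO) (Xi : measurableType dXi)
    (P : probability Omega R) (xi : nat -> {RV P >-> Xi}) : Prop :=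
  forall (J : {fset nat}) (A : nat -> set Xi),
    (forall k, measurable (A k)) ->
    P (\bigcap_(k in [set` J]) (xi k @^-1` A k)) =
    (\prod_(k <- J) P (xi k @^-1` A k))%E.

Definition iid (R : realType) (dO dXi : measure_display)
    (Omega : measurableType dO) (Xi : measurableType dXi)
    (P : probability Omega R) (Q : probability Xi R)
    (xi : nat -> {RV P >-> Xi}) : Prop :=
  mutually_independent xi /\
  forall k (A : set Xi), measurable A -> distribution P (xi k) A = Q A.

(* The sigma-algebra generated by xi 0, ..., xi (t - 1). *)
Definition history (R : realType) (dO dXi : measure_display)
    (Omega : measurableType dO) (Xi : measurableType dXi)
    (P : probability Omega R) (xi : nat -> {RV P >-> Xi}) (t : nat) :
    set (set Omega) :=
  <<s \bigcup_(k in [set k | (k < t)%N])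
        preimage_set_system setT (xi k) measurable >>.

(* Coordinatewise measurability, i.e. measurability for the Borel sets
   of R^d. *)
Definition adapted (R : realType) (d : nat) (dO dXi : measure_display)
    (Omega : measurableType dO) (Xi : measurableType dXi)
    (P : probability Omega R) (xi : nat -> {RV P >-> Xi})
    (x : nat -> Omega -> 'rV[R]_d) : Prop :=
  forall t (i : 'I_d) (B : set R), measurable B ->
    history xi t [set w | B (x t w 0 i)].

(* Time starts at 0: x t and xi t are the (t+1)-st iterate and sample, so that
   x t is a function of xi 0, ..., xi (t - 1).  When the arg min is not unique,
   adaptedness says that the minimizer is selected measurably and without
   looking at future samples. *)
Definition mirror_descent (R : realType) (d : nat) (dO dXi : measure_display)
    (Omega : measurableType dO) (Xi : measurableType dXi)
    (P : probability Omega R) (X : set 'rV[R]_d) (psi : 'rV[R]_d -> R)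
    (F : Xi -> 'rV[R]_d -> R) (eta : R) (xi : nat -> {RV P >-> Xi})
    (x1 : 'rV[R]_d) (x : nat -> Omega -> 'rV[R]_d) : Prop :=
  [/\ forall w, x 0%N w = x1,
      forall t w,
        argmin_on X (mirror_objective psi eta
          (gradient (F (xi t w)) (x t w)) (x t w)) (x t.+1 w)
    & adapted xi x].

(* Main.v *)
Require Import Defs.
From HB Require Import structures.
From mathcomp Require Import all_boot all_order all_algebra finmap.
From mathcomp Require Import all_classical all_reals all_analysis measurable_realfun.
From mathcomp Require Import ring lra.
Set Implicit Arguments.
Unset Strict Implicit.
Unset Printing Implicit Defensive.
Import Order.TTheory GRing.Theory Num.Theory.
Import numFieldNormedType.Exports.
Local Open Scope classical_set_scope.
Local Open Scope ring_scope.

(* Write B for the Bregman divergence of psi. First-order optimality of u, a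
   minimizer of the mirror step from y with sample s, and smoothness of f_s with
   eta <= 1/L give
     B(x*; u) <= B(x*; y) + eta <grad f_s(y), x* - y> + eta (f_s(y) - inf_X f_s).
   Averaging over s and using strong convexity of f bounds the mean of the right
   side by (1 - mu eta) B(x*; y) + eta sigma^2.  As the t-th sample is independent
   of the history, to which the t-th iterate is adapted, Tonelli's theorem turns
   this into the same recursion for E[B(x*; x_t)].  If 1 - mu eta < 0 the
   recursion cannot be iterated, but then B vanishes identically. *)

(** * The null sequence 1/(k+2) of step lengths *)

Lemma invSS_gt0 {R : realType} (k : nat) : 0 < k.+2%:R^-1 :> R.
Proof. by rewrite invr_gt0. Qed.

Lemma invSS_lt1 {R : realType} (k : nat) : k.+2%:R^-1 < 1 :> R.
Proof. by rewrite invf_lt1// ltr1n. Qed.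

(** The limit is taken in punctured neighbourhoods of 0, so that it composes with the limit defining
    a directional derivative. *)
Lemma cvg_invSS {R : realType} : (k.+2%:R^-1 : R) @[k --> \oo] --> (0 : R)^'.
Proof.
have h : (k.+2%:R^-1 : R) @[k --> \oo] --> (0 : R).
  by have := @cvg_harmonic R; rewrite -(cvg_shiftS (@harmonic R)).
move=> A A0; have := h _ A0; apply: (@filterS nat \oo) => k /=; apply.
by apply: lt0r_neq0; exact: invSS_gt0.
Qed.

(** * Gradients as limits of difference quotients *)

Section gradient.
Context {R : realType} {d : nat}.
Implicit Types (h : 'rV[R]_d -> R) (u v x y z : 'rV[R]_d).

Lemma dotpDr u v w : dotp u (v + w) = dotp u v + dotp u w.
Proof.
by rewrite /dotp -big_split; apply: eq_bigr => i _; rewrite mxE mulrDr.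
Qed.

Lemma dotpNr u v : dotp u (- v) = - dotp u v.
Proof.
by rewrite /dotp -sumrN; apply: eq_bigr => i _; rewrite mxE mulrN.
Qed.

Lemma dotpBr u v w : dotp u (v - w) = dotp u v - dotp u w.
Proof. by rewrite dotpDr dotpNr. Qed.

Lemma dotpZr u a v : dotp u (a *: v) = a * dotp u v.
Proof.
by rewrite /dotp mulr_sumr; apply: eq_bigr => i _; rewrite mxE mulrCA.
Qed.

Lemma dotp_gradient h y v : differentiable (h : _ -> R^o) y ->
  dotp (gradient h y) v = 'D_v (h : _ -> R^o) y.
Proof.
move=> dh; rewrite deriveE// [in RHS](row_sum_delta v) linear_sum.
by apply: eq_bigr => i _; rewrite linearZ /= mxE deriveE// mulrC.
Qed.

(* The steps k.+2%:R^-1 are < 1, so that moving from an interior point of D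
   towards a point of D stays in the interior. *)
Definition diff_quotient h y v (k : nat) : R :=
  k.+2%:R * (h (y + k.+2%:R^-1 *: v) - h y).

Lemma cvg_diff_quotient h y v : differentiable (h : _ -> R^o) y ->
  diff_quotient h y v @ \oo --> dotp (gradient h y) v.
Proof.
move=> dh; rewrite dotp_gradient//.
have dv : (fun t : R => t^-1 *: ((h : _ -> R^o) (t *: v + y) - h y)) @ 0^' -->
    'D_v (h : _ -> R^o) y by exact: diff_derivable.
rewrite [X in X @ _ --> _](_ : _ = (fun t : R => t^-1 *:
    ((h : _ -> R^o) (t *: v + y) - h y)) \o (fun k => k.+2%:R^-1)).
  exact: cvg_comp cvg_invSS dv.
by apply/funext => k /=; rewrite invrK /diff_quotient (addrC y).
Qed.

End gradient.

(** * Convexity, Bregman divergences and the deterministic mirror step *)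

Section convexity.
Context {R : realType} {d : nat}.
Implicit Types (X D : set 'rV[R]_d) (h : 'rV[R]_d -> R) (u v x y z : 'rV[R]_d).

Lemma segmentE x y (t : R) : y + t *: (x - y) = t *: x + (1 - t) *: y.
Proof.
by rewrite scalerBr scalerBl scale1r addrCA [y + _]addrC addrA addrAC.
Qed.

Lemma convex_segment X x y (t : R) :
  convex_set (X : set (convex_lmodType 'rV[R]_d)) -> X x -> X y ->
  0 <= t <= 1 -> X (y + t *: (x - y)).
Proof.
move=> cX Xx Xy /andP[t0 t1].
rewrite segmentE.
exact: set_mem (cX x y (Itv01 t0 t1) (mem_set Xx) (mem_set Xy)).
Qed.

Lemma convex_function_segment D h x y (t : R) :
  @convex_function R 'rV[R]_d (D : set (convex_lmodType 'rV[R]_d)) h ->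
  D x -> D y -> 0 <= t <= 1 ->
  h (y + t *: (x - y)) <= h y + t * (h x - h y).
Proof.
move=> ch Dx Dy /andP[t0 t1].
have : h (t *: x + (1 - t) *: y) <= t * h x + (1 - t) * h y.
  exact: ch (Itv01 t0 t1) x y (mem_set Dx) (mem_set Dy).
by rewrite segmentE; move/le_trans; apply; lra.
Qed.

(** The continuous map [g] inverts z -> t x + (1 - t) z, so all points near the given one are convex
    combinations of x with points of D. *)
Lemma interior_segment D x y (t : R) :
  convex_set (D : set (convex_lmodType 'rV[R]_d)) -> D x -> D° y ->
  0 <= t < 1 -> D° (y + t *: (x - y)).
Proof.
move=> cD Dx Dy /andP[t0 t1].
have t1' : 1 - t != 0 by rewrite gt_eqF// subr_gt0.
pose g z := (1 - t)^-1 *: (z - t *: x).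
have gE : g (y + t *: (x - y)) = y.
  by rewrite /g segmentE addrAC subrr add0r scalerA mulVf// scale1r.
have cg : {for y + t *: (x - y), continuous g}.
  apply: (@continuousZ _ _ _ (fun=> (1 - t)^-1) (fun z => z - t *: x)).
    exact: cst_continuous.
  by apply: continuousB; [exact: cvg_id|exact: cst_continuous].
rewrite /interior/=.
have : nbhs (y + t *: (x - y)) (g @^-1` D) by apply: cg; rewrite gE.
apply: filterS => z /= Dgz.
have -> : z = g z + t *: (x - g z).
  by rewrite segmentE scalerA divff// scale1r addrC subrK.
by apply: convex_segment => //; rewrite t0 ltW.
Qed.

Lemma segmentSS_itv (k : nat) : 0 <= (k.+2%:R^-1 : R) < 1.
Proof. by rewrite invSS_lt1 ltW// invSS_gt0. Qed.

Lemma segmentSS_itvc (k : nat) : 0 <= (k.+2%:R^-1 : R) <= 1.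
Proof. by rewrite !ltW// ?invSS_lt1// invSS_gt0. Qed.

(** By convexity every difference quotient at y towards x is at most h(x) - h(y); the limit is the
    gradient inequality. *)
Lemma bregman_ge0 D h x y :
  @convex_function R 'rV[R]_d (D : set (convex_lmodType 'rV[R]_d)) h ->
  D x -> D y -> differentiable (h : _ -> R^o) y -> 0 <= bregman h x y.
Proof.
move=> ch Dx Dy dh; rewrite subr_ge0.
apply: (cvgr_to_le (cvg_diff_quotient (v := x - y) dh)); apply: nearW => k.
rewrite /diff_quotient -ler_pdivlMl// lerBlDl.
exact: convex_function_segment ch Dx Dy (segmentSS_itvc k).
Qed.

(** The variational inequality at u, times eta: compare u with u + t (z - u), which lies in X,
    divide by t and let t tend to 0. The rest of the objective is affine, so only [psi] needs a
    limit. *)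
Lemma mirror_argmin_gradient X psi (eta : R) g y u z :
  convex_set (X : set (convex_lmodType 'rV[R]_d)) -> 0 < eta ->
  differentiable (psi : _ -> R^o) u ->
  argmin_on X (mirror_objective psi eta g y) u -> X z ->
  dotp (gradient psi y) (z - u) - eta * dotp g (z - u) <=
  dotp (gradient psi u) (z - u).
Proof.
move=> cX eta0 dpsi [Xu umin] Xz.
apply: (cvgr_to_ge (cvg_diff_quotient (v := z - u) dpsi)); apply: nearW => k.
have := umin _ (convex_segment cX Xz Xu (segmentSS_itvc k)).
rewrite /diff_quotient -ler_pdivrMl//; move: (z - u) => v; set t := k.+2%:R^-1.
rewrite -(ler_pM2l eta0) /mirror_objective /bregman !mulrDr !mulVKf ?gt_eqF//.
rewrite [u + _ - y]addrAC !dotpDr !dotpZr.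
lra.
Qed.

(** Three-point identity B(z; u) = B(z; y) - B(u; y) + <grad psi(y) - grad psi(u), z - u>, whose
    inner product is at most eta <g, z - u> by first-order optimality. *)
Lemma three_point X psi (eta : R) g y u z :
  convex_set (X : set (convex_lmodType 'rV[R]_d)) -> 0 < eta ->
  differentiable (psi : _ -> R^o) u ->
  argmin_on X (mirror_objective psi eta g y) u -> X z ->
  bregman psi z u <= bregman psi z y + eta * dotp g (z - u) - bregman psi u y.
Proof.
move=> cX eta0 dpsi umin Xz.
have := mirror_argmin_gradient cX eta0 dpsi umin Xz.
by rewrite /bregman !dotpBr; lra.
Qed.

(** In [three_point], split z - u into (z - y) + (y - u), where <grad h(y), y - u> = h(y) - h(u) +
    B_h(u; y). The term eta B_h(u; y) is absorbed by - B_psi(u; y). *)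
Lemma mirror_step X D psi h (eta L : R) y u z :
  convex_set (X : set (convex_lmodType 'rV[R]_d)) -> X `<=` D ->
  @convex_function R 'rV[R]_d (D : set (convex_lmodType 'rV[R]_d)) psi ->
  (forall y, D° y -> differentiable (psi : _ -> R^o) y) ->
  0 < eta -> 0 < L -> eta <= L^-1 -> rel_smooth X D psi L h ->
  (X `&` D°) y -> D° u ->
  argmin_on X (mirror_objective psi eta (gradient h y) y) u -> X z ->
  bregman psi z u <= bregman psi z y + eta * dotp (gradient h y) (z - y) +
    eta * (h y - h u).
Proof.
move=> cX XD cpsi dpsi eta0 L0 etaL hs [Xy Dy] Du umin Xz.
have Xu := umin.1.
have := three_point cX eta0 (dpsi _ Du) umin Xz.
have B0 : 0 <= bregman psi u y.
  by apply: bregman_ge0 cpsi (XD _ Xu) (XD _ Xy) (dpsi _ Dy).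
(* Enlarging the factor L of relative smoothness to 1/eta uses B_psi(u; y) >= 0. *)
have : eta * bregman h u y <= bregman psi u y.
  rewrite -ler_pdivlMl//; apply: le_trans (hs _ _ Xu (conj Xy Dy)) _.
  by apply: ler_wpM2r => //; rewrite -[L]invrK lef_pV2// posrE// invr_gt0.
by rewrite {1}/bregman !dotpBr; lra.
Qed.

End convexity.

(** * Joint measurability of Caratheodory functions along a random point *)

Section caratheodory.

(** A preimage is a countable union of measurable pieces, on each of which [c] is constant. *)
Lemma measurable_fun_countable_glue {I : countType} {d1 d2}
    {T : measurableType d1} {U : measurableType d2} (c : T -> I)
    (g : I -> T -> U) :
  (forall z, measurable (c @^-1` [set z])) ->
  (forall z, measurable_fun setT (g z)) ->
  measurable_fun setT (fun t => g (c t) t).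
Proof.
move=> mc mg _ B mB; rewrite setTI.
rewrite (_ : _ @^-1` B = \bigcup_z (c @^-1` [set z] `&` g z @^-1` B)).
  apply: countable_bigcupT_measurable; first exact: countableP.
  move=> z; apply: measurableI => //.
  by rewrite -[X in measurable X]setTI; exact: mg.
apply/seteqP; split=> [t Bt|t [z _ [/= <-]]//].
by exists (c t).
Qed.

Context {R : realType} {d : nat}.

(** Label of the half-open cube of side 1/(n+1) that contains y; the labels form a countable
    type. *)
Definition grid_cell (n : nat) (y : 'rV[R]_d) : {ffun 'I_d -> int} :=
  [ffun i => Num.floor (n.+1%:R * y 0 i)].

Lemma grid_cell_dist n (y z : 'rV[R]_d) i :
  grid_cell n y = grid_cell n z -> `|y 0 i - z 0 i| < n.+1%:R^-1.
Proof.
move=> /(congr1 (fun f : {ffun 'I_d -> int} => f i)); rewrite !ffunE => e.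
rewrite -(@ltr_pM2l _ n.+1%:R)// divff// -[X in X * _]ger0_norm// -normrM mulrBr.
have /andP[] := floor_itv (n.+1%:R * y 0 i).
have /andP[] := floor_itv (n.+1%:R * z 0 i).
rewrite e !intrD => h1 h2 h3 h4.
by rewrite ltr_norml; apply/andP; split; lra.
Qed.

Context {dS dT} {S : measurableType dS} {T : measurableType dT}.
Variables (C : set 'rV[R]_d) (u : T -> 'rV[R]_d).
Hypothesis Cu : forall w, C (u w).
Hypothesis mu : forall i, measurable_fun setT (fun w => u w 0 i).

Lemma measurable_grid_cell n z :
  measurable ((fun p : S * T => grid_cell n (u p.2)) @^-1` [set z]).
Proof.
rewrite (_ : _ @^-1` _ = \bigcap_(i in [set: 'I_d])
   ((fun p : S * T => n.+1%:R * u p.2 0 i) @^-1` `[(z i)%:~R, (z i + 1)%:~R[)).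
  apply: fin_bigcap_measurable => // i _.
  rewrite -[X in measurable X]setTI.
  have : measurable_fun [set: S * T] (fun p => n.+1%:R * u p.2 0 i).
    apply: measurable_funM => //.
    exact: (measurableT_comp (mu i)).
  by apply.
apply/seteqP; split => p /=.
  move=> <- i _ /=; rewrite ffunE in_itv/=.
  exact: floor_itv.
move=> H; apply/ffunP => i; rewrite ffunE; apply: floor_def.
by have := H i I; rewrite /= in_itv.
Qed.

(* u is approximated by countably valued maps: each grid cell of mesh 1/(n+1)
   that u meets is represented by one of its points in C. *)
Lemma measurable_caratheodory (phi : S -> 'rV[R]_d -> R) :
  (forall y, C y -> measurable_fun setT (phi ^~ y)) ->
  (forall s y, C y -> {for y, continuous (phi s)}) ->
  measurable_fun setT (fun p : S * T => phi p.1 (u p.2)).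
Proof.
move=> mphi cphi.
(* The default [u point] lies in C, so every representative does, even that of a cell missing C. *)
pose rep n z := xget (u point) [set y | C y /\ grid_cell n y = z].
have Crep n z : C (rep n z) by rewrite /rep; case: xgetP => [y _ []|//].
have rep_cell n w : grid_cell n (rep n (grid_cell n (u w))) = grid_cell n (u w).
  by rewrite /rep; case: xgetP => [y _ []//|/(_ (u w)) []].
apply: (@measurable_fun_cvg _ _ _ setT
  (fun n p => phi p.1 (rep n (grid_cell n (u p.2))))).
  move=> n; apply: (@measurable_fun_countable_glue _ _ _ _ _
    (fun p => grid_cell n (u p.2)) (fun z p => phi p.1 (rep n z))).
    by move=> z; exact: measurable_grid_cell.
  by move=> z; apply: measurableT_comp (mphi _ (Crep n z)) _.
move=> [s w] _ /=.
(* Continuity of [phi s] at [u w] leaves the convergence of the representatives; they share the cell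
   of [u w], so each coordinate differs by less than 1/(n+1). *)
apply: (cvg_comp _ _ _ (cphi s (u w) (Cu w))) => A /nbhs_ballP[e/= e0 eA].
have [N _ hN] := near_infty_natSinv_lt (PosNum e0).
exists N => // n Nn; apply: eA; split => // i j; rewrite ord1 /ball/=.
apply: lt_trans (hN _ Nn); apply: grid_cell_dist.
by rewrite rep_cell.
Qed.

End caratheodory.

(* The difference quotients towards z only evaluate phi s on C, unlike those
   defining the partial derivatives. *)
Lemma measurable_gradient_toward {R : realType} {d : nat} {dS dT}
    {S : measurableType dS} {T : measurableType dT} (C : set 'rV[R]_d)
    (u : T -> 'rV[R]_d) (z : 'rV[R]_d) (phi : S -> 'rV[R]_d -> R) :
  (forall w, C (u w)) ->
  (forall i, measurable_fun setT (fun w => u w 0 i)) ->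
  (forall y k, C y -> C (y + k.+2%:R^-1 *: (z - y))) ->
  (forall y, C y -> measurable_fun setT (phi ^~ y)) ->
  (forall s y, C y -> differentiable (phi s : _ -> R^o) y) ->
  measurable_fun setT
    (fun p : S * T => dotp (gradient (phi p.1) (u p.2)) (z - u p.2)).
Proof.
move=> Cu mu Cz mphi dphi.
have cphi s y : C y -> {for y, continuous (phi s)}.
  by move=> Cy; exact: differentiable_continuous (dphi s y Cy).
apply: (@measurable_fun_cvg _ _ _ setT
  (fun k p => diff_quotient (phi p.1) (u p.2) (z - u p.2) k)); last first.
  by move=> p _; apply: cvg_diff_quotient; exact: dphi.
move=> k; apply: measurable_funM => //; apply: measurable_funB.
  apply: (@measurable_caratheodory _ _ _ _ _ _ C
    (fun w => u w + k.+2%:R^-1 *: (z - u w))) => //.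
    by move=> w; exact: Cz.
  move=> i; under eq_fun do rewrite !mxE.
  apply: measurable_funD => //; apply: measurable_funM => //.
  exact: measurable_funB.
exact: (@measurable_caratheodory _ _ _ _ _ _ C u Cu mu phi mphi cphi).
Qed.

(** * Independence of a sample from the past *)

Section independence.
Context {R : realType} {dO dXi} {Omega : measurableType dO}
  {Xi : measurableType dXi} {P : probability Omega R}.
Variables (Q : probability Xi R) (xi : nat -> {RV P >-> Xi}).
Hypothesis xi_iid : iid Q xi.

(* The sample space equipped with the history sigma-algebra: it plays the role
   of the space of values of the t-th iterate, with P as its law. *)
Let past t := g_sigma_algebraType (\bigcup_(k in [set k | (k < t)%N])
  preimage_set_system setT (xi k) measurable).

Lemma history_measurable t : history xi t `<=` measurable.
Proof.
apply: smallest_sub; first exact: sigma_algebra_measurable.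
by move=> _ [k _ [B mB <-]]; exact: measurable_funPT.
Qed.

(** A pi-system whose sigma-algebra contains the history; on it, independence from [xi t] is a
    product formula. *)
Let cylinder t : set (set Omega) := [set B | exists A : nat -> set Xi,
  (forall k, measurable (A k)) /\
  B = \bigcap_(k in [set` seq_fset tt (iota 0 t)]) (xi k @^-1` A k)].

Let cylinder_measurable t : cylinder t `<=` measurable.
Proof.
move=> _ [A [mA ->]]; apply: fin_bigcap_measurable => // k _.
by rewrite -[X in measurable X]setTI; exact: measurable_funPT.
Qed.

Let cylinder_setI t : setI_closed (cylinder t).
Proof.
move=> _ _ [A [mA ->]] [B [mB ->]]; exists (fun k => A k `&` B k); split.
  by move=> k; exact: measurableI.
by rewrite -bigcapI.
Qed.

Let history_cylinder t : history xi t `<=` <<s cylinder t >>.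
Proof.
apply: smallest_sub; first exact: smallest_sigma_algebra.
move=> _ [k /= kt [B mB <-]]; apply: sub_sigma_algebra.
exists (fun j => if j == k then B else setT); split.
  by move=> j; case: ifP.
rewrite setTI; apply/seteqP; split => [w Bw j _ /=|w].
  by case: eqP => // ->.
have kt' : k \in seq_fset tt (iota 0 t) by rewrite seq_fsetE mem_iota.
by move=> /(_ k kt'); rewrite /= eqxx.
Qed.

(** Mutual independence is used twice, over J and over J with t added; [C'] puts A in place t. *)
Let independent_fset (J : {fset nat}) t A C : measurable A ->
  (forall k, measurable (C k)) -> t \notin J ->
  P ((\bigcap_(k in [set` J]) (xi k @^-1` C k)) `&` xi t @^-1` A) =
  (Q A * P (\bigcap_(k in [set` J]) (xi k @^-1` C k)))%E.
Proof.
move=> mA mC tJ; have [indep law] := xi_iid.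
pose C' k := if k == t then A else C k.
have mC' k : measurable (C' k) by rewrite /C'; case: ifP.
have C't : C' t = A by rewrite /C' eqxx.
have C'E k : k \in J -> C' k = C k.
  by rewrite /C'; case: eqP => // -> h; rewrite h in tJ.
have := indep (t |` J)%fset C' mC'.
rewrite big_fsetU1// C't.
rewrite -[P (xi t @^-1` A)]/(distribution P (xi t) A) law//.
rewrite (eq_big_seq (fun k => P (xi k @^-1` C k))); last first.
  by move=> k kJ; rewrite C'E.
rewrite -(indep J C mC) => <-; congr (P _).
apply/seteqP; split => [w [Jw tw] k /=|w Jw].
  by rewrite in_fset1U => /orP[/eqP->|kJ]; rewrite ?C't// C'E//; exact: Jw.
split => [k kJ|]; last by rewrite -C't; apply: Jw => /=; rewrite fset1U1.
by rewrite -C'E//; apply: Jw; rewrite /= in_fset1U (_ : k \in J) ?orbT.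
Qed.

(** Both sides are finite measures in B that agree on the cylinders, hence on the sigma-algebra
    these generate. *)
Lemma history_independent t A B : measurable A -> history xi t B ->
  P (xi t @^-1` A `&` B) = (Q A * P B)%E.
Proof.
move=> mA /history_cylinder tB.
have mxA : measurable (xi t @^-1` A).
  by rewrite -[X in measurable X]setTI; exact: measurable_funPT.
have QA : (fine (Q A))%:E = Q A by rewrite fineK// fin_num_measure.
have QA0 : 0 <= fine (Q A) by rewrite fine_ge0.
rewrite setIC -QA.
apply: (@g_sigma_algebra_measure_unique _ R Omega (cylinder t)
  (@cylinder_measurable t) (fun=> setT) _ _
  (mrestr P mxA) (mscale (NngNum QA0) P) (@cylinder_setI t) _ _ B tB).
- move=> _; exists (fun=> setT); split => //.
  by apply/esym; rewrite -subTset => w _ k _.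
- by apply/seteqP; split => // w _; exists 0%N.
- move=> _ [C [mC ->]].
  rewrite -[LHS]/(P (_ `&` _)) -[RHS]/((fine (Q A))%:E * P _)%E.
  by rewrite QA independent_fset// seq_fsetE mem_iota/= ltnn.
- move=> _; rewrite -[X in (X < _)%E]/(P (setT `&` _)).
  by rewrite (le_lt_trans (probability_le1 _ _)) ?ltry// setTI.
Qed.

Lemma measurable_fun_past t dY (Y : measurableType dY) (f : Omega -> Y) :
  measurable_fun [set: past t] f -> measurable_fun [set: Omega] f.
Proof.
move=> mf _ B mB; have := mf measurableT _ mB; rewrite !setTI.
exact: history_measurable.
Qed.

Lemma measurable_sample_past t :
  measurable_fun [set: Omega] (fun w => (xi t w, w : past t)).
Proof.
apply: measurable_fun_pair => //.
by apply: (@measurable_fun_past t _ (past t)); exact: measurable_id.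
Qed.

(** Freezing the past: by independence the joint law of the sample and the past is a product
    measure, and Tonelli's theorem splits the integral. *)
Lemma integral_independent t (G : Xi * past t -> \bar R) :
  measurable_fun setT G -> (forall p, (0 <= G p)%E) ->
  (\int[P]_w G (xi t w, w) = \int[P]_w \int[Q]_s G (s, w))%E.
Proof.
move=> mG G0.
have mid : measurable_fun [set: Omega] (id : Omega -> past t).
  by apply: (@measurable_fun_past t _ (past t)); exact: measurable_id.
have mj := @measurable_sample_past t.
(* [PH] is P restricted to the history, written as the law of the identity map. *)
pose PH := distribution P (mfun_Sub (mem_set mid) : {RV P >-> past t}).
rewrite -[LHS]/(\int[P]_w (G \o (fun w => (xi t w, w : past t))) w)%E.
rewrite -(ge0_integral_pushforward mj P measurableT mG)//.
transitivity (\int[Q \x PH]_p G p)%E.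
  apply: eq_measure_integral => B mB _; apply/esym.
  apply: product_measure_unique => // A1 A2 mA1 mA2.
  rewrite -[RHS](@history_independent t A1 A2)//.
rewrite fubini_tonelli2//.
rewrite ge0_integral_pushforward//.
- exact: measurable_fun_fubini_tonelli_G.
- by move=> w _; exact: integral_ge0.
Qed.

End independence.

(** The truncated integrand is nonnegative everywhere, as Tonelli's theorem requires, while [h] is
    so only almost everywhere. *)
Lemma ae_ge0_integral_maxr {d} {T : measurableType d} {R : realType}
    (m : {measure set T -> \bar R}) (h : T -> R) :
  measurable_fun setT h -> {ae m, forall t, 0 <= h t} ->
  (\int[m]_t (Num.max 0 (h t))%:E = \int[m]_t (h t)%:E)%E.
Proof.
move=> mh h0; apply: ae_eq_integral => //.
- by apply/measurable_EFinP; exact: measurable_maxr.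
- exact/measurable_EFinP.
- by apply: filterS h0 => t ht _; rewrite /= max_r.
Qed.

(** * Averaging over the sample *)

Section mean_function.
Context {R : realType} {d : nat} {dXi : measure_display}
  {Xi : measurableType dXi}.
Variables (X D : set 'rV[R]_d) (psi : 'rV[R]_d -> R) (Q : probability Xi R)
  (F : Xi -> 'rV[R]_d -> R).
Hypothesis F_integrable : forall z, X z ->
  Q.-integrable [set: Xi] (fun s => (F s z)%:E).
Hypothesis gradF_integrable : forall y (i : 'I_d), (X `&` D°) y ->
  Q.-integrable [set: Xi] (fun s => (gradient (F s) y 0 i)%:E).
Hypothesis gradF_unbiased : forall y (i : 'I_d), (X `&` D°) y ->
  'E_Q[fun s => (gradient (F s) y 0 i)%R]%E = (gradient (mean_fun Q F) y 0 i)%:E.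

Lemma integral_mean_fun z : X z ->
  (\int[Q]_s (F s z)%:E)%E = (mean_fun Q F z)%:E.
Proof.
move=> Xz; rewrite /mean_fun unlock fineK//.
by apply: integrable_fin_num => //; exact: F_integrable.
Qed.

Lemma dotp_gradient_integrable y v : (X `&` D°) y ->
  Q.-integrable [set: Xi] (fun s => (dotp (gradient (F s) y) v)%:E).
Proof.
move=> Cy; under eq_fun do rewrite -sumEFin.
apply: integrable_sum => // i _; under eq_fun do rewrite mulrC EFinM.
by apply: integrableZl => //; exact: gradF_integrable.
Qed.

Lemma integral_dotp_gradient y v : (X `&` D°) y ->
  (\int[Q]_s (dotp (gradient (F s) y) v)%:E)%E =
  (dotp (gradient (mean_fun Q F) y) v)%:E.
Proof.
move=> Cy; under eq_integral do rewrite -sumEFin.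
rewrite integral_sum//; last first.
  move=> i; under eq_fun do rewrite mulrC EFinM.
  by apply: integrableZl => //; exact: gradF_integrable.
rewrite -sumEFin; apply: eq_bigr => i _.
under eq_integral do rewrite mulrC EFinM.
rewrite integralZl//; last exact: gradF_integrable.
by have := gradF_unbiased i Cy; rewrite unlock => ->; rewrite -EFinM mulrC.
Qed.

(** Serves two averages: r is minus the value of f_s at a second point when smoothness is averaged,
    and - eta inf_X f_s in the one-step bound. *)
Lemma integral_affine_combination y z v (a b c : R) (r : Xi -> R) :
  X z -> (X `&` D°) y -> Q.-integrable [set: Xi] (fun s => (r s)%:E) ->
  Q.-integrable [set: Xi]
    (fun s => (a + b * F s z + c * dotp (gradient (F s) y) v + r s)%:E) /\
  (\int[Q]_s (a + b * F s z + c * dotp (gradient (F s) y) v + r s)%:E =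
    (a + b * mean_fun Q F z + c * dotp (gradient (mean_fun Q F) y) v)%:E +
    \int[Q]_s (r s)%:E)%E.
Proof.
move=> Xz Cy ir.
have ia : Q.-integrable [set: Xi] (fun=> a%:E).
  exact: finite_measure_integrable_cst.
have iF : Q.-integrable [set: Xi] (fun s => b%:E * (F s z)%:E)%E.
  by apply: integrableZl => //; exact: F_integrable.
have iG : Q.-integrable [set: Xi] (fun s => c%:E * (dotp (gradient (F s) y) v)%:E)%E.
  by apply: integrableZl => //; exact: dotp_gradient_integrable.
have iaF := integrableD measurableT ia iF.
have iaFG := integrableD measurableT iaF iG.
have E s : (a + b * F s z + c * dotp (gradient (F s) y) v + r s)%:E =
  (((a%:E + b%:E * (F s z)%:E) + c%:E * (dotp (gradient (F s) y) v)%:E) + (r s)%:E)%E.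
  by rewrite !EFinD !EFinM.
split; first by rewrite (funext E); have := integrableD measurableT iaFG ir.
under eq_integral do rewrite E.
rewrite integralD// integralD// integralD// !integralZl//; last 2 first.
- exact: dotp_gradient_integrable.
- exact: F_integrable.
rewrite integral_cst//.
rewrite [X in (a%:E * X)%E](probability_setT Q) mule1 integral_mean_fun//.
by rewrite integral_dotp_gradient// !EFinD !EFinM.
Qed.

(** Smoothness of f_s at (z, y) reads L B(z; y) + f_s(y) + <grad f_s(y), z - y> - f_s(z) >= 0;
    integrate over s. *)
Lemma mean_rel_smooth (L : R) : {ae Q, forall s, rel_smooth X D psi L (F s)} ->
  rel_smooth X D psi L (mean_fun Q F).
Proof.
move=> F_smooth z y Xz Cy.
have Xy := Cy.1.
have [] := @integral_affine_combination y y (z - y) (L * bregman psi z y) 1 1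
  (fun s => - F s z) Xy Cy (integrableN (F_integrable Xz)).
set h := (X in Q.-integrable _ (fun s => (X s)%:E)) => ih eh.
have h0 : {ae Q, forall s, 0 <= h s}.
  apply: filterS F_smooth => s /(_ z y Xz Cy).
  by rewrite {1}/bregman /h; lra.
have mh : measurable_fun setT h by apply/measurable_EFinP; case/integrableP: ih.
have /esym := ae_ge0_integral_maxr mh h0.
rewrite eh; under [X in (_ + X)%E]eq_integral do rewrite -mulN1r EFinM.
rewrite integralZl//; last exact: F_integrable.
rewrite integral_mean_fun// -EFinM -EFinD => e.
have : (0 <= \int[Q]_s (Num.max 0 (h s))%:E)%E.
  by apply: integral_ge0 => s _; rewrite lee_fin le_max lexx.
by rewrite -e lee_fin /bregman; lra.
Qed.

End mean_function.

(** * Finiteness and sign of sigma^2 *)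

Section optimal_difference.
Context {R : realType} {d : nat} {dXi : measure_display}
  {Xi : measurableType dXi}.
Variables (X : set 'rV[R]_d) (Q : probability Xi R) (F : Xi -> 'rV[R]_d -> R)
  (z : 'rV[R]_d).
Hypothesis Xz : X z.
Hypothesis F_integrable : Q.-integrable [set: Xi] (fun s => (F s z)%:E).
Hypothesis infF_measurable : measurable_fun [set: Xi] (fun s => inf_on X (F s)).
Hypothesis sigma2_fin : (sigma2 Q X F z < +oo)%E.

Lemma inf_on_le (h : 'rV[R]_d -> R) y : X y -> (inf_on X h <= (h y)%:E)%E.
Proof. by move=> Xy; apply: ereal_inf_lbound; exists y. Qed.

(** The positive part is at most |f_s(z)|, and an infinite integral of the negative part would force
    sigma^2 = +oo. *)
Lemma inf_on_integrable : Q.-integrable [set: Xi] (fun s => inf_on X (F s)).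
Proof.
apply/integrableP; split => //.
set g := fun s => inf_on X (F s).
have mg : measurable_fun setT g by [].
have gp : (\int[Q]_s g^\+ s < +oo)%E.
  have /integrableP[mF] := F_integrable; apply: le_lt_trans.
  apply: ge0_le_integral => //.
  - exact: measurable_funepos.
  - exact: measurableT_comp.
  - move=> s _; rewrite funeposE ge_max; apply/andP; split => //.
    exact: le_trans (inf_on_le _ Xz) (lee_abs _).
have gn : (\int[Q]_s g^\- s < +oo)%E.
  rewrite ltey; apply/eqP => gn; move: sigma2_fin.
  rewrite /sigma2 integralE -/g gn.
  have : (0 <= \int[Q]_s g^\+ s)%E by exact: integral_ge0.
  by case: (\int[Q]_s g^\+ s)%E gp => //= a _ _; rewrite ?ltxx.
rewrite [X in (X < _)%E](_ : _ = \int[Q]_s g^\+ s + \int[Q]_s g^\- s)%E.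
  exact: lte_add_pinfty.
rewrite -ge0_integralD//; last 2 first.
- exact: measurable_funepos.
- exact: measurable_funeneg.
by apply: eq_integral => s _; rewrite -/(g s) -[LHS]/((abse \o g) s) fune_abse.
Qed.

Lemma inf_on_fin_num : {ae Q, forall s, inf_on X (F s) \is a fin_num}.
Proof.
apply: filterS (integrable_ae measurableT inf_on_integrable) => s; exact.
Qed.

Let fine_inf_ae : ae_eq Q setT (fun s => (fine (inf_on X (F s)))%:E)
  (fun s => inf_on X (F s)).
Proof. by apply: filterS inf_on_fin_num => s fs _; rewrite /= fineK. Qed.

Let measurable_fine_inf : measurable_fun setT (fun s => fine (inf_on X (F s))).
Proof. exact: measurableT_comp. Qed.

Lemma fine_inf_on_integrable :
  Q.-integrable [set: Xi] (fun s => (fine (inf_on X (F s)))%:E).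
Proof.
apply: le_integrable inf_on_integrable => //; first exact/measurable_EFinP.
by move=> s _; case: (inf_on X (F s)) => //=; rewrite normr0 leey.
Qed.

Lemma sigma2E : sigma2 Q X F z = ((mean_fun Q F z)%:E -
  \int[Q]_s (fine (inf_on X (F s)))%:E)%E.
Proof.
rewrite /sigma2; congr (_ - _)%E; apply: ae_eq_integral => //.
- exact/measurable_EFinP.
- exact: ae_eq_sym.
Qed.

Lemma sigma2_fin_num : sigma2 Q X F z \is a fin_num.
Proof.
rewrite sigma2E fin_numB/=.
by apply: integrable_fin_num => //; exact: fine_inf_on_integrable.
Qed.

(** Integrate inf_X f_s <= f_s(z). *)
Lemma sigma2_ge0 : (0 <= sigma2 Q X F z)%E.
Proof.
rewrite /sigma2 sube_ge0; last first.
  by rewrite integrable_fin_num//; exact: inf_on_integrable.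
have -> : (mean_fun Q F z)%:E = (\int[Q]_s (F s z)%:E)%E.
  by rewrite /mean_fun unlock fineK// integrable_fin_num.
apply: le_integral => //; first exact: inf_on_integrable.
by move=> s _; exact: inf_on_le.
Qed.

End optimal_difference.

(** * The recursion for the mean divergence *)

Section stochastic_mirror_descent.
Context {R : realType} {d : nat} {dXi dO : measure_display}
  {Xi : measurableType dXi} {Omega : measurableType dO}.
Variables (X D : set 'rV[R]_d) (psi : 'rV[R]_d -> R) (Q : probability Xi R)
  (F : Xi -> 'rV[R]_d -> R) (mu L eta : R)
  (P : probability Omega R) (xi : nat -> {RV P >-> Xi})
  (x1 : 'rV[R]_d) (x : nat -> Omega -> 'rV[R]_d) (xs : 'rV[R]_d).
Hypothesis X_convex : convex_set (X : set (convex_lmodType 'rV[R]_d)).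
Hypothesis X_sub_D : X `<=` D.
Hypothesis D_convex : convex_set (D : set (convex_lmodType 'rV[R]_d)).
Hypothesis psi_convex :
  @convex_function R 'rV[R]_d (D : set (convex_lmodType 'rV[R]_d)) psi.
Hypothesis psi_diff : forall y, D° y -> differentiable (psi : _ -> R^o) y.
Hypothesis psi_interior : interior_condition X D psi.
Hypothesis F_integrable : forall z, X z ->
  Q.-integrable [set: Xi] (fun s => (F s z)%:E).
Hypothesis F_diff : forall s y, (X `&` D°) y ->
  differentiable (F s : _ -> R^o) y.
Hypothesis gradF_integrable : forall y (i : 'I_d), (X `&` D°) y ->
  Q.-integrable [set: Xi] (fun s => (gradient (F s) y 0 i)%:E).
Hypothesis gradF_unbiased : forall y (i : 'I_d), (X `&` D°) y ->
  'E_Q[fun s => (gradient (F s) y 0 i)%R]%E = (gradient (mean_fun Q F) y 0 i)%:E.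
Hypothesis infF_measurable :
  measurable_fun [set: Xi] (fun s => inf_on X (F s)).
Hypothesis Xxs : X xs.
Hypothesis sigma2_fin : (sigma2 Q X F xs < +oo)%E.
Hypothesis f_sc : rel_strongly_convex X D psi mu (mean_fun Q F).
Hypothesis L_gt0 : 0 < L.
Hypothesis F_smooth : {ae Q, forall s, rel_smooth X D psi L (F s)}.
Hypothesis eta_gt0 : 0 < eta.
Hypothesis eta_le : eta <= L^-1.
Hypothesis xi_iid : iid Q xi.
Hypothesis x1_in : (X `&` D°) x1.
Hypothesis x_smd : mirror_descent X psi F eta xi x1 x.

Let C := X `&` D°.

Let bregman_psi_ge0 z y : X z -> C y -> 0 <= bregman psi z y.
Proof.
move=> Xz [Xy Dy]; apply: bregman_ge0 psi_convex _ _ (psi_diff Dy);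
  exact: X_sub_D.
Qed.

(** The one-step bound with f_s(u) replaced by inf_X f_s, hence free of the next iterate u. *)
Let gain s y := bregman psi xs y + eta * dotp (gradient (F s) y) (xs - y) +
  eta * (F s y - fine (inf_on X (F s))).

(** The exceptional set of samples is chosen before y and u, so the bound may be used at a random
    iterate. *)
Let step_le_gain : {ae Q, forall s, forall y u, C y ->
  argmin_on X (mirror_objective psi eta (gradient (F s) y) y) u ->
  bregman psi xs u <= gain s y}.
Proof.
apply: filterS2 F_smooth
  (inf_on_fin_num Xxs (F_integrable Xxs) infF_measurable sigma2_fin).
move=> s Fs fs y u Cy umin.
have [_ /(_ u umin) Du] := @psi_interior y (gradient (F s) y) eta Cy eta_gt0.
apply: le_trans (mirror_step X_convex X_sub_D psi_convex psi_diff eta_gt0 L_gt0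
  eta_le Fs Cy Du umin Xxs) _.
rewrite lerD2l ler_pM2l// lerD2l lerN2 -lee_fin fineK//.
exact: inf_on_le umin.1.
Qed.

(** A minimizer u exists and lies in the interior of D, so the gain is at least B(xs; u) >= 0. *)
Let gain_ge0 : {ae Q, forall s, forall y, C y -> 0 <= gain s y}.
Proof.
apply: filterS step_le_gain => s gs y Cy.
have [[u umin] /(_ u umin) Du] :=
  @psi_interior y (gradient (F s) y) eta Cy eta_gt0.
by apply: le_trans (gs y u Cy umin); apply: bregman_psi_ge0 (conj umin.1 Du).
Qed.

Let fine_inf_int := fine_inf_on_integrable Xxs (F_integrable Xxs)
  infF_measurable sigma2_fin.

(** The mean gain is B + eta (f(y) + <grad f(y), xs - y>) - eta E[inf_X f_s] with B = B(xs; y), and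
    strong convexity bounds the bracket by f(xs) - mu B. *)
Let integral_gain_le y : C y ->
  (\int[Q]_s (Num.max 0 (gain s y))%:E <=
   ((1 - mu * eta) * bregman psi xs y + eta * fine (sigma2 Q X F xs))%:E)%E.
Proof.
move=> Cy.
have ri : Q.-integrable [set: Xi] (fun s => (- eta * fine (inf_on X (F s)))%:E).
  by under eq_fun do rewrite EFinM; exact: integrableZl.
have [] := integral_affine_combination F_integrable gradF_integrable
  gradF_unbiased (xs - y) (bregman psi xs y) eta eta Cy.1 Cy ri.
set h := (X in Q.-integrable _ (fun s => (X s)%:E)) => ih eh.
have hE : gain ^~ y = h by apply/funext => s; rewrite /h /gain; lra.
have mh : measurable_fun setT h by apply/measurable_EFinP; case/integrableP: ih.
have h0 : {ae Q, forall s, 0 <= h s}.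
  by apply: filterS gain_ge0 => s /(_ y Cy); rewrite -hE.
rewrite (_ : (fun s => _) = (fun s => (Num.max 0 (h s))%:E)); last by rewrite -hE.
rewrite ae_ge0_integral_maxr// eh.
under [X in (_ + X)%E]eq_integral do rewrite EFinM.
rewrite integralZl//.
rewrite (sigma2E Xxs (F_integrable Xxs))//.
have fr := integrable_fin_num measurableT fine_inf_int.
rewrite fineB// -[X in (_ + _ * X)%E]fineK// -EFinM -EFinD lee_fin /=.
have := f_sc Xxs Cy.
rewrite -(ler_pM2l eta_gt0) [bregman (mean_fun Q F) _ _]/bregman.
by set r := fine _; lra.
Qed.

Let x_in t w : C (x t w).
Proof.
have [x0 xS _] := x_smd.
elim: t w => [w|t IH w]; first by rewrite x0.
have [_] := @psi_interior (x t w) (gradient (F (xi t w)) (x t w)) eta (IH w) eta_gt0.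
by move=> /(_ _ (xS t w)) Dx; split => //; exact: (xS t w).1.
Qed.

Let segment_in y k : C y -> C (y + k.+2%:R^-1 *: (xs - y)).
Proof.
move=> [Xy Dy]; split; first exact: convex_segment (segmentSS_itvc k).
by apply: interior_segment (segmentSS_itv k) => //; exact: X_sub_D.
Qed.

Let past t := g_sigma_algebraType (\bigcup_(k in [set k | (k < t)%N])
  preimage_set_system setT (xi k) measurable).

Let measurable_x t i : measurable_fun [set: past t] (fun w => x t w 0 i).
Proof.
have [_ _ ad] := x_smd; move=> _ B mB; rewrite setTI.
exact: ad.
Qed.

Let diff_continuous (h : 'rV[R]_d -> R) y :
  differentiable (h : _ -> R^o) y -> {for y, continuous h}.
Proof. exact: differentiable_continuous. Qed.

Let measurable_F y : C y -> measurable_fun setT (F ^~ y).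
Proof.
by move=> Cy; apply/measurable_EFinP; case/integrableP: (F_integrable Cy.1).
Qed.

(** The sample is a dummy coordinate: the joint measurability results are applied to the constant
    family [psi]. *)
Let measurable_bregman_pair t :
  measurable_fun [set: Xi * past t] (fun p => bregman psi xs (x t p.2)).
Proof.
apply: measurable_funB; first apply: measurable_funB => //.
- apply: (@measurable_caratheodory _ _ _ _ _ _ C (x t : past t -> _) (x_in t)
    (@measurable_x t) (fun=> psi)) => // _ y Cy.
  by apply: diff_continuous; exact: psi_diff Cy.2.
- apply: (@measurable_gradient_toward _ _ _ _ _ _ C (x t : past t -> _) xs (fun=> psi)
    (x_in t) (@measurable_x t)) => // _ y Cy.
  exact: psi_diff Cy.2.
Qed.

Let measurable_bregman t : measurable_fun setT (fun w => bregman psi xs (x t w)).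
Proof.
have mb := measurable_fun_pair2 point (@measurable_bregman_pair t).
exact: measurable_fun_past mb.
Qed.

Let measurable_gain t :
  measurable_fun [set: Xi * past t] (fun p => gain p.1 (x t p.2)).
Proof.
apply: measurable_funD; first apply: measurable_funD => //.
- apply: measurable_funM => //.
  apply: (@measurable_gradient_toward _ _ _ _ _ _ C (x t : past t -> _) xs F
    (x_in t) (@measurable_x t)) => //.
- apply: measurable_funM => //; apply: measurable_funB.
    apply: (@measurable_caratheodory _ _ _ _ _ _ C (x t : past t -> _) (x_in t)
      (@measurable_x t) F) => // s y Cy.
    by apply: diff_continuous; exact: F_diff.
  have /measurable_EFinP mr : measurable_fun setT
    (fun s => (fine (inf_on X (F s)))%:E) by case/integrableP: fine_inf_int.
  exact: measurableT_comp mr _.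
Qed.

Let measurable_gain_pos t :
  measurable_fun [set: Xi * past t] (fun p => (Num.max 0 (gain p.1 (x t p.2)))%:E).
Proof.
by apply/measurable_EFinP; apply: measurable_maxr => //; exact: measurable_gain.
Qed.

Let mean_bregman_le_gain t :
  (\int[P]_w (bregman psi xs (x t.+1 w))%:E <=
   \int[P]_w (Num.max 0 (gain (xi t w) (x t w)))%:E)%E.
Proof.
apply: ae_ge0_le_integral => //.
- by move=> w _; rewrite lee_fin; apply: bregman_psi_ge0 (x_in _ _).
- exact/measurable_EFinP.
- by move=> w _; rewrite lee_fin le_max lexx.
- exact: measurableT_comp (@measurable_gain_pos t)
    (@measurable_sample_past _ _ _ _ _ _ xi t).
(* As [xi t] has law Q, it pulls the Q-null exceptional set back to a P-null set. *)
- have [N [mN QN subN]] := step_le_gain.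
  exists (xi t @^-1` N); split.
  + by rewrite -[X in measurable X]setTI; exact: measurable_funPT.
  + by have [_ law] := xi_iid; rewrite -QN -(law t).
  + move=> w /= H; apply: subN => /= H'; apply: H => _.
    rewrite lee_fin le_max; apply/orP; right; apply: H' (x_in _ _) _.
    by have [_ + _] := x_smd; apply.
Qed.

(** The sign condition allows the bound b to be multiplied by 1 - mu eta. *)
Let mean_bregman_step t (b : R) : 0 <= 1 - mu * eta ->
  (\int[P]_w (bregman psi xs (x t w))%:E <= b%:E)%E ->
  (\int[P]_w (bregman psi xs (x t.+1 w))%:E <=
   ((1 - mu * eta) * b + eta * fine (sigma2 Q X F xs))%:E)%E.
Proof.
move=> me0 Bb; apply: le_trans (mean_bregman_le_gain t) _.
(* The sample is now integrated first, under Q, with the iterate held fixed. *)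
rewrite (integral_independent xi_iid (@measurable_gain_pos t)); last first.
  by move=> p; rewrite lee_fin le_max lexx.
have s0 : 0 <= eta * fine (sigma2 Q X F xs).
  apply: mulr_ge0; first exact: ltW.
  by apply: fine_ge0; apply: sigma2_ge0 => //; exact: F_integrable.
have B0 w : 0 <= (1 - mu * eta) * bregman psi xs (x t w).
  by apply: mulr_ge0 => //; apply: bregman_psi_ge0 (x_in _ _).
apply: (@le_trans _ _ (\int[P]_w ((1 - mu * eta) * bregman psi xs (x t w) +
    eta * fine (sigma2 Q X F xs))%:E)%E).
  apply: ge0_le_integral => //.
  - by move=> w _; apply: integral_ge0 => s _; rewrite lee_fin le_max lexx.
  (* The inner integral is measurable for the history, hence for the full sigma-algebra. *)
  - apply: (@measurable_fun_past _ _ _ _ _ _ xi t).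
    have := @measurable_fun_fubini_tonelli_G _ _ _ _ _ Q _ (@measurable_gain_pos t).
    by apply=> p; rewrite lee_fin le_max lexx.
  - apply/measurable_EFinP; apply: measurable_funD => //.
    exact: measurable_funM.
  - by move=> w _; exact: integral_gain_le (x_in _ _).
under eq_integral do rewrite EFinD EFinM.
rewrite ge0_integralD//; last 2 first.
- by move=> w _; rewrite -EFinM lee_fin.
- by apply: measurable_funeM; exact/measurable_EFinP.
rewrite ge0_integralZl_EFin//; last 2 first.
- by move=> w _; rewrite lee_fin; apply: bregman_psi_ge0 (x_in _ _).
- exact/measurable_EFinP.
rewrite integral_cst// [X in (_ + _ * X)%E](probability_setT P) mule1.
rewrite [leRHS]EFinD [((1 - mu * eta) * b)%:E]EFinM; apply: leeD2r.
by apply: lee_wpmul2l.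
Qed.

(* Relative smoothness of the mean gives mu * B <= L * B for B = bregman psi z y,
   with L <= 1 / eta < mu. *)
Let bregman_eq0 z y : 1 - mu * eta < 0 -> X z -> C y -> bregman psi z y = 0.
Proof.
move=> me0 Xz Cy; apply/eqP; rewrite eq_le bregman_psi_ge0// andbT.
have sm := mean_rel_smooth F_integrable gradF_integrable gradF_unbiased F_smooth.
have := le_trans (f_sc Xz Cy) (sm _ _ Xz Cy).
have eL : L * eta <= 1 by rewrite mulrC -ler_pdivlMr// div1r.
move=> h; rewrite leNgt; apply/negP => B0; move: h; rewrite ler_pM2r// => muL.
have : mu * eta <= L * eta by rewrite ler_pM2r.
lra.
Qed.

Lemma mean_bregman_bound t : 0 < mu ->
  ('E_P[fun w => bregman psi xs (x t w)] <=
    ((1 - mu * eta) ^+ t * bregman psi xs x1)%:E +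
      sigma2 Q X F xs * (mu^-1)%:E)%E.
Proof.
move=> mu0; rewrite unlock.
have s2 := sigma2_ge0 Xxs (F_integrable Xxs) infF_measurable sigma2_fin.
rewrite -[sigma2 _ _ _ _]fineK ?sigma2_fin_num//; last exact: F_integrable.
have := fine_ge0 s2; set s := fine _ => s0.
rewrite -EFinM -EFinD.
have [me0|me0] := ltP (1 - mu * eta) 0.
  (* All divergences vanish, and the claim becomes 0 <= sigma^2 / mu. *)
  under eq_integral do rewrite bregman_eq0//.
  rewrite integral0 bregman_eq0// mulr0 add0r lee_fin.
  by rewrite mulr_ge0// invr_ge0 ltW.
elim: t => [|t IH].
  have [x0 _ _] := x_smd.
  under eq_integral do rewrite x0.
  rewrite integral_cst// [X in (_ * X)%E](probability_setT P) mule1.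
  by rewrite lee_fin expr0 mul1r lerDl mulr_ge0// invr_ge0 ltW.
apply: le_trans (mean_bregman_step me0 IH) _; rewrite lee_fin -/s.
(* Since sigma^2 / mu is the fixed point of b -> (1 - mu eta) b + eta sigma^2, the recursion carries
   the bound at t exactly to the bound at t + 1. *)
rewrite exprS le_eqVlt; apply/orP; left; apply/eqP.
by field; rewrite gt_eqF.
Qed.

End stochastic_mirror_descent.

Unset Implicit Arguments.

Theorem theorem1 (R : realType) (d : nat)
    (X D : set 'rV[R]_d) (psi : 'rV[R]_d -> R)
    (dXi : measure_display) (Xi : measurableType dXi) (Q : probability Xi R)
    (F : Xi -> 'rV[R]_d -> R) (mu L eta : R)
    (dO : measure_display) (Omega : measurableType dO)
    (P : probability Omega R) (xi : nat -> {RV P >-> Xi})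
    (x1 : 'rV[R]_d) (x : nat -> Omega -> 'rV[R]_d)
    (X_neq0 : X !=set0) (X_closed : closed X)
    (X_convex : convex_set (X : set (convex_lmodType 'rV[R]_d)))
    (X_sub_D : X `<=` D)
    (D_convex : convex_set (D : set (convex_lmodType 'rV[R]_d)))
    (psi_convex :
      @convex_function R 'rV[R]_d (D : set (convex_lmodType 'rV[R]_d)) psi)
    (psi_diff : forall y, D° y -> differentiable (psi : _ -> R^o) y)
    (psi_interior : interior_condition X D psi)
    (F_integrable : forall z, X z ->
      Q.-integrable [set: Xi] (fun s => (F s z)%:E))
    (F_integrable_near : forall y, (X `&` D°) y ->
      \forall z \near y, Q.-integrable [set: Xi] (fun s => (F s z)%:E))
    (F_diff : forall s y, (X `&` D°) y ->
      differentiable (F s : _ -> R^o) y)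
    (f_diff : forall y, (X `&` D°) y ->
      differentiable (mean_fun Q F : _ -> R^o) y)
    (gradF_integrable : forall y (i : 'I_d), (X `&` D°) y ->
      Q.-integrable [set: Xi] (fun s => (gradient (F s) y 0 i)%:E))
    (gradF_unbiased : forall y (i : 'I_d), (X `&` D°) y ->
      'E_Q[fun s => (gradient (F s) y 0 i)%R]%E =
      (gradient (mean_fun Q F) y 0 i)%:E)
    (infF_measurable :
      measurable_fun [set: Xi] (fun s => inf_on X (F s)))
    (Xstar_neq0 : argmin_on X (mean_fun Q F) !=set0)
    (sigma2_fin : forall xstar, argmin_on X (mean_fun Q F) xstar ->
      (sigma2 Q X F xstar < +oo)%E)
    (mu_gt0 : 0 < mu)
    (f_sc : rel_strongly_convex X D psi mu (mean_fun Q F))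
    (L_gt0 : 0 < L)
    (F_smooth : {ae Q, forall s, rel_smooth X D psi L (F s)})
    (eta_gt0 : 0 < eta) (eta_le : eta <= L^-1)
    (xi_iid : iid Q xi)
    (x1_in : (X `&` D°) x1)
    (x_smd : mirror_descent X psi F eta xi x1 x) :
  forall xstar, argmin_on X (mean_fun Q F) xstar ->
  forall t : nat, (1 <= t)%N ->
    ('E_P[fun w => bregman psi xstar (x t w)] <=
      ((1 - mu * eta) ^+ t * bregman psi xstar x1)%:E +
      sigma2 Q X F xstar * (mu^-1)%:E)%E.
Proof.
move=> xstar [Xxstar min_xstar] t _.
apply: (@mean_bregman_bound _ _ _ _ _ _ X D psi Q F mu L eta
  P xi x1) => //.
by apply: sigma2_fin; split.
Qed.
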